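(* Let $X$ be a Baire space, $Y$ a topological space, $(Z,d)$ a metric space, and $f:X\times Y\to Z$ a mapping. Suppose that for every $y$ in a dense subset of $Y$, the collection $\mathcal A(Y)$ of somewhere dense subsets of $Y$ includes a countable network at $y$ in $Y$. If $f^y$ is quasicontinuous for each $y\in Y$ and $f_x$ is continuous for each $x\in X$, then $f$ is quasicontinuous.
   Context: No separation axioms are assumed on topological spaces. Sections: for $f:X\times Y\to Z$, put $f_x:Y\to Z$, $f_x(y)=f(x,y)$, and $f^y:X\to Z$, $f^y(x)=f(x,y)$. A mapping $g:T\to Z$ from a topological space $T$ to a metric space $(Z,d)$ is quasicontinuous if for every $\varepsilon>0$, every $t\in T$ and every neighborhood $V$ of $t$ in $T$ there is a nonempty open set $O\subset V$ with $d(g(t),g(s))<\varepsilon$ for each $s\in O$. A subset $F\subset Y$ is somewhere dense in $Y$ if $\mathrm{Int}(\overline F)\neq\emptyset$. A network at $y$ in $Y$ is a collection $\mathcal N$ of subsets of $Y$ such that every neighborhood of $y$ in $Y$ contains some nonempty member of $\mathcal N$. *)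

(* Defs.v *)
From mathcomp Require Import all_boot all_order all_algebra.
From mathcomp Require Import all_classical all_reals all_analysis.

Set Implicit Arguments.
Unset Strict Implicit.
Unset Printing Implicit Defensive.

Local Open Scope classical_set_scope.
Local Open Scope ring_scope.

Definition baire_space (X : topologicalType) : Prop :=
  forall U : (set X)^nat,
    (forall n, open (U n) /\ dense (U n)) -> dense (\bigcap_n U n).

(* The topology of a [metricType] is the one induced by its distance [mdist]. *)
Definition quasicontinuous (R : realType) (T : topologicalType)
    (Z : metricType R) (g : T -> Z) : Prop :=
  forall (eps : R), 0 < eps -> forall (t : T) (V : set T), nbhs t V ->
    exists O : set T, [/\ open O, O !=set0, O `<=` V &
      forall s, O s -> mdist (g t) (g s) < eps].

Definition somewhere_dense (Y : topologicalType) (F : set Y) : Prop :=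
  interior (closure F) !=set0.

Definition somewhere_dense_sets (Y : topologicalType) : set (set Y) :=
  [set F | somewhere_dense F].
Arguments somewhere_dense_sets Y : clear implicits.

(* Members of a network at [y] are not required to contain [y]. *)
Definition network_at (Y : topologicalType) (y : Y) (N : set (set Y)) : Prop :=
  forall V : set Y, nbhs y V ->
    exists F : set Y, [/\ N F, F !=set0 & F `<=` V].

(* Main.v *)
Require Import Defs.
From mathcomp Require Import all_boot all_order all_algebra.
From mathcomp Require Import all_classical all_reals all_analysis.
From mathcomp Require Import lra.

(** Fix [(x0, y0)] and a box [U `*` V] around it.  Continuity of [f (x0, _)]
    moves [y0] to a point [y1] of [V] having a countable network of somewhere
    dense sets, and quasicontinuity of [f (_, y1)] shrinks [U] to a nonempty
    open set on which [f (_, y1)] stays close to [f (x0, y0)].  For each [x]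
    of this set, continuity of [f (x, _)] at [y1] provides a member [F] of the
    network, inside [V], such that [f (x, _)] stays close to [f (x0, y0)] on
    [F].  The choice of [F] depends on [x], but there are only countably many
    choices, so by the Baire property one and the same [F] serves for a set
    [A] of points that is dense in some nonempty open [U'].  It remains to
    pass from [A `*` F] to a box: a quasicontinuous map that stays in a closed
    ball on a dense subset of an open set stays in this ball on the whole open
    set ([quasicontinuous_mdist_le_closure]).  This extends the estimate from
    [A] to [U'] for each fixed [y] in [F], and then from [F] to the interior
    of its closure for each fixed [x] in [U'].  The second extension uses the
    same lemma, as continuous maps are quasicontinuous. *)

Set Implicit Arguments.
Unset Strict Implicit.

Import Order.TTheory GRing.Theory Num.Theory.
Local Open Scope classical_set_scope.
Local Open Scope ring_scope.

Lemma continuous_near_mdist_lt (R : realType) (T : topologicalType)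
    (Z : metricType R) (g : T -> Z) (t : T) (e : R) :
  continuous g -> 0 < e -> nbhs t [set s | mdist (g t) (g s) < e].
Proof.
by move=> cg; exact: (metricType_numDomainType.cvgr_dist_lt (cg t)).
Qed.

Lemma continuous_quasicontinuous (R : realType) (T : topologicalType)
    (Z : metricType R) (g : T -> Z) :
  continuous g -> quasicontinuous g.
Proof.
move=> cg e e0 t V Vt.
exists (V `&` [set s | mdist (g t) (g s) < e])°; split.
- exact: open_interior.
- by exists t; apply: filterI => //; exact: continuous_near_mdist_lt.
- by move=> s /interior_subset[].
- by move=> s /interior_subset[].
Qed.

(** Quasicontinuity at [x] does not give points close to [x] in the whole of
    a neighborhood, but it gives a nonempty open set of points [s] with [g s]
    close to [g x], and such a set must meet any set that is dense around
    [x]. *)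
Lemma quasicontinuous_mdist_le_closure (R : realType) (T : topologicalType)
    (Z : metricType R) (g : T -> Z) (U A : set T) (c : Z) (r : R) :
  quasicontinuous g -> open U -> U `<=` closure A ->
  (forall s, A s -> mdist c (g s) <= r) ->
  forall x, U x -> mdist c (g x) <= r.
Proof.
move=> qg oU UA Ar x Ux; apply/ler_addgt0Pr => e e0.
have [B [oB [t Bt] BU Be]] := qg e e0 x U (open_nbhs_nbhs (conj oU Ux)).
have [s [As Bs]] := UA t (BU t Bt) B (open_nbhs_nbhs (conj oB Bt)).
rewrite (le_trans (metric_triangle _ (g s) _))// lerD ?Ar//.
by rewrite metric_sym ltW ?Be.
Qed.

(** If all the sets [A i] were nowhere dense in [U], the complements of the
    closures of the [U `&` A i] would be countably many dense open sets, and
    their intersection would miss [U]. *)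
Lemma baire_countable_cover (X : topologicalType) (J : Type) (N : set J)
    (A : J -> set X) (U : set X) :
  baire_space X -> countable N -> open U -> U !=set0 ->
  U `<=` \bigcup_(i in N) A i ->
  exists2 i, N i & U `&` (closure (A i))° !=set0.
Proof.
move=> bX /pfcard_geP[N0 _ [x Ux] /(_ x Ux)|[s] oU U0 UA].
  by rewrite N0 => -[].
apply: contrapT => nwd.
(* Outside [U] the closure of [A (s n)] may well have interior points, so its
   complement need not be dense; intersecting with [U] first repairs this and
   does not change what happens inside [U]. *)
pose V (n : nat) := ~` closure (U `&` A (s n)).
have V_open_dense n : open (V n) /\ dense (V n).
  split; first by apply/closed_openC/closed_closure.
  move=> O [x Ox] oO; apply: contrapT => OV.
  have Ocl : O `<=` closure (U `&` A (s n)).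
    by move=> y Oy; apply: contrapT => ny; apply: OV; exists y.
  have [y [[Uy Ay] Oy]] := Ocl x Ox O (open_nbhs_nbhs (conj oO Ox)).
  apply: nwd; exists (s n); first exact: funS.
  exists y; split=> //; rewrite /interior.
  apply: filterS (open_nbhs_nbhs (conj oO Oy)).
  by apply: subset_trans Ocl _; apply: closureS => z [].
have [x [Ux Vx]] := bX V V_open_dense U U0 oU.
have [i Ni Aix] := UA x Ux.
have [n _ sni] : range s i by exact: (@surj _ _ _ _ s).
by apply: (Vx n I); apply: subset_closure; split=> //; rewrite sni.
Qed.

(** The Baire step: the neighborhoods of [y1] on which [f (x, _)] stays in a
    closed ball depend on [x], and the conclusion makes them uniform over a
    nonempty open set, at the price of moving away from [y1]. *)
Lemma uniform_mdist_le_box (R : realType) (X Y : topologicalType)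
    (Z : metricType R) (f : X * Y -> Z) (N : set (set Y)) (y1 : Y)
    (U : set X) (V : set Y) (c : Z) (r : R) :
  baire_space X ->
  (forall y, quasicontinuous (fun x => f (x, y))) ->
  (forall x, quasicontinuous (fun y => f (x, y))) ->
  N `<=` somewhere_dense_sets Y -> countable N -> network_at y1 N ->
  open U -> U !=set0 -> open V ->
  (forall x, U x -> nbhs y1 (V `&` [set y | mdist c (f (x, y)) <= r])) ->
  exists U' V', [/\ open U', U' !=set0 & U' `<=` U] /\
    [/\ open V', V' !=set0, V' `<=` V &
        forall x y, U' x -> V' y -> mdist c (f (x, y)) <= r].
Proof.
move=> bX qX qY Nsd cN netN oU U0 oV near_y1.
pose A F := [set x | F `<=` V `&` [set y | mdist c (f (x, y)) <= r]].
have UA : U `<=` \bigcup_(F in N) A F.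
  by move=> x /near_y1/netN[F [NF _ FV]]; exists F.
have [F NF [x [Ux clAx]]] := baire_countable_cover bX cN oU U0 UA.
have FV : F `<=` V.
  by have [x' [AFx' _]] := interior_subset clAx _ filterT; move=> y /AFx'[].
pose U' := U `&` (closure (A F))°; pose V' := V `&` (closure F)°.
have oU' : open U' by apply: openI => //; exact: open_interior.
have oV' : open V' by apply: openI => //; exact: open_interior.
have rF y : F y -> forall x, U' x -> mdist c (f (x, y)) <= r.
  move=> Fy; apply: (quasicontinuous_mdist_le_closure (A := A F) (qX y) oU').
    by move=> ? [_ /interior_subset].
  by move=> s /(_ y Fy)[].
exists U', V'; split.
  by split=> //; [exists x | move=> ? []].
split=> //.
- (* The interior of the closure of [F] might leave [V], but being open it
     meets [F], which lies in [V]. *)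
  have [y cly] : somewhere_dense F := Nsd F NF.
  have [z [Fz clz]] := interior_subset cly _
    (open_nbhs_nbhs (conj (open_interior _) cly)).
  by exists z; split=> //; exact: FV.
- by move=> ? [].
- move=> x' y Ux' V'y.
  apply: (quasicontinuous_mdist_le_closure (A := F) (qY x') oV' _ _ V'y).
    by move=> ? [_ /interior_subset].
  by move=> s Fs; exact: rF.
Qed.

Unset Implicit Arguments.

Theorem corollary3p8 (R : realType) (X Y : topologicalType) (Z : metricType R)
    (f : X * Y -> Z)
    (hX : baire_space X)
    (hY : exists D : set Y, dense D /\
       forall y, D y -> exists N : set (set Y),
         [/\ N `<=` somewhere_dense_sets Y, countable N & network_at y N])
    (hfy : forall y : Y, quasicontinuous (fun x : X => f (x, y)))
    (hfx : forall x : X, continuous (fun y : Y => f (x, y))) :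
  quasicontinuous f.
Proof.
(* The estimate follows the path from [f (x0, y0)] through [f (x0, y1)] and
   [f (x, y1)] to [f (x, y)], whose three steps are each shorter than [e]; a
   quarter of [eps] makes the non-strict bound [3 * e] smaller than [eps]. *)
move=> eps eps0 [x0 y0] W [[U V] /= [Ux0 Vy0] UVW].
have [D [dD netD]] := hY.
pose e := eps / 4%:R; have e0 : 0 < e by rewrite /e; lra.
have [y1 [y1V Dy1]] : ((V `&` [set y | mdist (f (x0, y0)) (f (x0, y)) < e])°
    `&` D) !=set0.
  apply: dD; last exact: open_interior.
  by exists y0; apply: filterI => //; exact: continuous_near_mdist_lt.
have [_ e01] := interior_subset y1V.
have [U1 [oU1 U10 U1U e1x]] := hfy y1 e e0 x0 U Ux0.
have [N [Nsd cN netN]] := netD y1 Dy1.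
have near_y1 x : U1 x ->
    nbhs y1 (V° `&` [set y | mdist (f (x0, y0)) (f (x, y)) <= 3%:R * e]).
  move=> U1x; apply: filterI.
    by apply: filterS (open_nbhs_nbhs (conj (open_interior _) y1V));
      apply: interiorS => y [].
  apply: filterS (continuous_near_mdist_lt y1 (hfx x) e0) => y /= exy.
  have := metric_triangle (f (x0, y0)) (f (x0, y1)) (f (x, y)).
  have := metric_triangle (f (x0, y1)) (f (x, y1)) (f (x, y)).
  move: e01 (e1x x U1x) exy => /=; lra.
have [U' [V' [[oU' [x U'x] U'U1] [oV' [y V'y] V'V fUV]]]] :=
  uniform_mdist_le_box hX hfy
    (fun x => continuous_quasicontinuous (hfx x))
    Nsd cN netN oU1 U10 (open_interior V) near_y1.
exists (U' `*` V'); split.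
- rewrite openE => -[a b] [/= U'a V'b]; exists (U', V') => //.
  by split; exact: open_nbhs_nbhs.
- by exists (x, y).
- move=> -[a b] [/= U'a V'b]; apply: UVW; split; first exact/U1U/U'U1.
  exact: interior_subset (V'V b V'b).
- move=> -[a b] [/= U'a V'b]; have := fUV a b U'a V'b.
  by move: e0; rewrite /e; lra.
Qed.
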